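(* Let $\alpha\ge2$ be an integer and let $\{\chi^k_{i_1\cdots i_k}\}$ be the zero-mean correctors and $g^{m}$ the tensors defined in the context. Then, for every $1\le r\le\lfloor\alpha/2\rfloor$, the tensor $$g^{2r}_{i_1\cdots i_{2r+2}}=\tfrac1{|Y|}\big(a(\nabla_y\chi^{2r+1}_{i_2\cdots i_{2r+2}}+e_{i_2}\chi^{2r}_{i_3\cdots i_{2r+2}}),e_{i_1}\big)_Y$$ satisfies $$g^{2r}=_S(-1)^rk^r+h^r,$$ where $k^r,h^r\in\mathrm{Ten}^{2r+2}(\mathbb{R}^d)$ are $$k^r_{i_1\cdots i_{2r+2}}=-\big\langle a\nabla_y\chi^{r+1}_{i_1\cdots i_{r+1}}\cdot\nabla_y\chi^{r+1}_{i_{r+2}\cdots i_{2r+2}}\big\rangle_Y+\big\langle ae_{i_2}\chi^r_{i_3\cdots i_{r+2}}\cdot e_{i_1}\chi^r_{i_{r+3}\cdots i_{2r+2}}\big\rangle_Y,$$ $$h^r=\sum_{j=1}^{\lceil r/2\rceil}\sum_{\ell=1}^{\lceil r/2\rceil}\big\langle g^{2(r-j-\ell+1)}\otimes\chi^{2j-1}\otimes\chi^{2\ell-1}\big\rangle_Y-\sum_{j=1}^{\lfloor r/2\rfloor}\sum_{\ell=1}^{\lfloor r/2\rfloor}\big\langle g^{2(r-j-\ell)}\otimes\chi^{2j}\otimes\chi^{2\ell}\big\rangle_Y,$$ and the second double sum in $h^r$ vanishes for $r=1$.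
   Context: Setting. $Y=(0,\ell_1)\times\cdots\times(0,\ell_d)$; $a(y)$ is a $d\times d$ symmetric $Y$-periodic tensor with $\lambda|\xi|^2\le a(y)\xi\cdot\xi\le\Lambda|\xi|^2$ for all $\xi\in\mathbb{R}^d$, a.e. $y$ ($\lambda,\Lambda>0$). $W_{\mathrm{per}}(Y)$ is the space of zero-mean functions of $H^1_{\mathrm{per}}(Y)$ (closure of smooth $Y$-periodic functions in $H^1(Y)$). $(\cdot,\cdot)_Y$ is the $L^2(Y)$ inner product, $\langle v\rangle_Y=\frac1{|Y|}\int_Yv$ and $e_i$ the canonical basis of $\mathbb{R}^d$. Tensors. $\mathrm{Ten}^n(\mathbb{R}^d)$: tensors of order $n$. $(S^n(q))_{i_1\cdots i_n}=\frac1{n!}\sum_{\sigma}q_{i_{\sigma(1)}\cdots i_{\sigma(n)}}$ (all permutations), also written $S^n_{i_1\cdots i_n}\{q_{i_1\cdots i_n}\}$; $p=_Sq$ means $S^n(p)=S^n(q)$. $(p\otimes q)_{i_1\cdots i_{m+n}}=p_{i_1\cdots i_m}q_{i_{m+1}\cdots i_{m+n}}$. Correctors. Set $\chi^0=1$ and let $\chi^1_i\in W_{\mathrm{per}}(Y)$ solve $(a\nabla_y\chi^1_i,\nabla_yw)_Y=-(ae_i,\nabla_yw)_Y$ for all $w\in W_{\mathrm{per}}(Y)$. Inductively, for $m\ge0$ let $$g^m_{i_1\cdots i_{m+2}}=\tfrac1{|Y|}\big(a(\nabla_y\chi^{m+1}_{i_2\cdots i_{m+2}}+e_{i_2}\chi^m_{i_3\cdots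 i_{m+2}}),e_{i_1}\big)_Y,\qquad p^m=g^m\ (m\text{ even}),\quad p^m=0\ (m\text{ odd}),$$ and for $k\ge1$ let the symmetric tensor $\chi^{k+1}$ have components in $W_{\mathrm{per}}(Y)$ such that for all $w\in H^1_{\mathrm{per}}(Y)$ $$(a\nabla_y\chi^{k+1}_{i_1\cdots i_{k+1}},\nabla_yw)_Y=S^{k+1}_{i_1\cdots i_{k+1}}\Big\{-(ae_{i_1}\chi^k_{i_2\cdots i_{k+1}},\nabla_yw)_Y+\big(a(\nabla_y\chi^k_{i_2\cdots i_{k+1}}+e_{i_2}\chi^{k-1}_{i_3\cdots i_{k+1}}),e_{i_1}w\big)_Y-\sum_{j=0}^{k-1}\big((p^{k-1-j}\otimes\chi^j)_{i_1\cdots i_{k+1}},w\big)_Y\Big\}.$$ (These problems are uniquely solvable; for odd $m$ it is known that $g^m=_S0$. In particular $g^0=a^0$ is the homogenized tensor.) *)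

(* Defs.v *)
(* Real numbers are an abstract [R : realType] (mathcomp-analysis); a point of
   R^d is a column vector ['cV[R]_d]. *)
From HB Require Import structures.
From mathcomp Require Import all_boot all_order all_algebra all_fingroup.
From mathcomp Require Import all_classical all_reals all_analysis.

Set Implicit Arguments.
Unset Strict Implicit.
Unset Printing Implicit Defensive.

Import Order.TTheory GRing.Theory Num.Theory.
Import numFieldNormedType.Exports.

Local Open Scope classical_set_scope.
Local Open Scope ring_scope.

Section cV_measurable.
Context {R : realType} (n : nat).

Definition cV_coord (i : 'I_n) (y : 'cV[R]_n) : measurableTypeR R := y i 0.

Let cV_set0 : g_sigma_preimage cV_coord set0.
Proof. exact: sigma_algebra0. Qed.

Let cV_setC A : g_sigma_preimage cV_coord A -> g_sigma_preimage cV_coord (~` A).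
Proof. exact: sigma_algebraC. Qed.

Let cV_bigcup (F : (set 'cV[R]_n)^nat) :
  (forall i, g_sigma_preimage cV_coord (F i)) ->
  g_sigma_preimage cV_coord (\bigcup_i (F i)).
Proof. exact: sigma_algebra_bigcup. Qed.

Definition cV_display : measure_display.
Proof. exact: default_measure_display. Qed.

(* The Borel sigma-algebra of R^n, generated by the coordinate functions. *)
HB.instance Definition _ := @isMeasurable.Build cV_display
  'cV[R]_n (g_sigma_preimage cV_coord) cV_set0 cV_setC cV_bigcup.

End cV_measurable.

Section cV_lebesgue.
Context {R : realType}.

Lemma measurable_cV_coord n (i : 'I_n) :
  measurable_fun [set: 'cV[R]_n] (fun y => y i 0 : measurableTypeR R).
Proof.
move=> _ Y mY; rewrite setTI; apply: sub_sigma_algebra => /=.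
rewrite -bigcup_seq/=; exists i => /=; first by rewrite mem_index_enum.
by exists Y => //; rewrite setTI.
Qed.

Lemma measurable_cVP d1 (T1 : measurableType d1) n (f : T1 -> 'cV[R]_n) :
  (forall i, measurable_fun [set: T1] (fun x => f x i 0 : measurableTypeR R)) ->
  measurable_fun [set: T1] f.
Proof.
move=> mf _ A mA; rewrite setTI.
have : g_sigma_preimage (fun i => cV_coord i \o f) (f @^-1` A).
  by rewrite g_sigma_preimage_comp; exists A => //; rewrite setTI.
apply: smallest_sub; first exact: sigma_algebra_measurable.
rewrite -bigcup_seq/= => B [i _ [C mC <-]].
exact: (mf i measurableT C mC).
Qed.

Definition cV_cons n (p : measurableTypeR R * 'cV[R]_n) : 'cV[R]_n.+1 :=
  \col_i oapp (fun j => p.2 j 0) p.1 (unlift ord0 i).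

Definition cV_uncons n (y : 'cV[R]_n.+1) : measurableTypeR R * 'cV[R]_n :=
  (y ord0 0, \col_j y (lift ord0 j) 0).

Lemma cV_consK n : cancel (@cV_cons n) (@cV_uncons n).
Proof.
move=> [x y]; congr pair; rewrite ?mxE ?unlift_none//=.
by apply/colP => j; rewrite !mxE liftK.
Qed.

Lemma measurable_cV_cons n : measurable_fun [set: _] (@cV_cons n).
Proof.
apply: measurable_cVP => i; case: (unliftP ord0 i) => [j|] ->.
  rewrite (_ : (fun _ => _) = (fun y : 'cV[R]_n => y j 0) \o snd).
    exact: measurableT_comp (measurable_cV_coord j) _.
  by apply/funext => p /=; rewrite mxE liftK.
rewrite (_ : (fun _ => _) = fst); first exact: measurable_fst.
by apply/funext => p; rewrite mxE unlift_none.
Qed.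

Lemma measurable_cV_uncons n : measurable_fun [set: _] (@cV_uncons n).
Proof.
apply: measurable_fun_pair; first exact: measurable_cV_coord.
apply: measurable_cVP => i; under eq_fun do rewrite mxE.
exact: measurable_cV_coord.
Qed.

Section cons_measure.
Variables (n : nat) (mu : {sigma_finite_measure set 'cV[R]_n -> \bar R}).

Definition cons_measure : set 'cV[R]_n.+1 -> \bar R :=
  pushforward (@lebesgue_measure R \x mu)%E (@cV_cons n).

Let cons_measure0 : cons_measure set0 = 0%E.
Proof. by rewrite /cons_measure /pushforward preimage_set0 measure0. Qed.

Let cons_measure_ge0 A : (0 <= cons_measure A)%E.
Proof. by rewrite /cons_measure /pushforward measure_ge0. Qed.

Let cons_measure_sigma_additive : semi_sigma_additive cons_measure.
Proof.
exact: (@measure_semi_sigma_additive _ _ _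
  (measure_function_pushforward__canonical__measure_function_Measure
     (@lebesgue_measure R \x mu)%E (@measurable_cV_cons n))).
Qed.

HB.instance Definition _ := isMeasure.Build _ _ _ cons_measure
  cons_measure0 cons_measure_ge0 cons_measure_sigma_additive.

Let cons_measure_sigma_finite : sigma_finite setT cons_measure.
Proof.
have /sigma_finiteP[F [TF ndF Foo]] := sigma_finiteT (@lebesgue_measure R).
have /sigma_finiteP[G [TG ndG Goo]] := sigma_finiteT mu.
exists (fun k => @cV_uncons n @^-1` (F k `*` G k)).
  rewrite -preimage_bigcup (_ : \bigcup_k _ = setT) ?preimage_setT//.
  rewrite -subTset -setXTT TF TG => -[x y] [[i _ Fix] [j _ Gjy]].
  exists (maxn i j) => //; split.
  - by move/subsetPset: (ndF _ _ (leq_maxl i j)); exact.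
  - by move/subsetPset: (ndG _ _ (leq_maxr i j)); exact.
move=> k; have [mF Fk] := Foo k; have [mG Gk] := Goo k; split.
  rewrite -[X in measurable X]setTI.
  by apply: measurable_cV_uncons => //; exact: measurableX.
rewrite /cons_measure /pushforward -comp_preimage.
rewrite (_ : _ \o _ = id); last by apply/funext => p; exact: cV_consK.
by rewrite preimage_id product_measure1E// lte_mul_pinfty// ge0_fin_numE.
Qed.

HB.instance Definition _ := Measure_isSigmaFinite.Build _ _ _ cons_measure
  cons_measure_sigma_finite.

End cons_measure.

(* Lebesgue measure on R^n, as an iterated product measure. *)
Fixpoint leb n : {sigma_finite_measure set 'cV[R]_n -> \bar R} :=
  if n is m.+1 then cons_measure (leb m) else dirac (0 : 'cV[R]_0).

End cV_lebesgue.

Section periodicity_cell.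
Context {R : realType} {d : nat} (ell : 'cV[R]_d).
Local Notation Rd := 'cV[R]_d.

Definition cell : set Rd := [set y | forall i, 0 < y i 0 < ell i 0].

Lemma measurable_cell : measurable cell.
Proof.
rewrite (_ : cell = \bigcap_(i in [set: 'I_d])
    ((fun y : Rd => y i 0 : measurableTypeR R) @^-1` `]0, ell i 0[)).
  apply: fin_bigcap_measurable => // i _; rewrite -[X in measurable X]setTI.
  by apply: measurable_cV_coord => //; exact: measurable_itv.
by apply/seteqP; split => y /= Yy i; [move=> _|have := Yy i Logic.I];
  rewrite /= ?set_itvoo /=; [exact: Yy|].
Qed.

End periodicity_cell.

Lemma leb_cell (R : realType) d (ell : 'cV[R]_d) : (forall i, 0 <= ell i 0) ->
  leb d (cell ell) = (\prod_(i < d) ell i 0)%:E.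
Proof.
elim: d ell => [|n IHn] l l0 /=.
  by rewrite diracE big_ord0 mem_set// => -[].
pose l' : 'cV[R]_n := \col_i l (lift ord0 i) 0.
rewrite /cons_measure /pushforward.
rewrite (_ : _ @^-1` _ =
    `]0, l ord0 0[%classic `*` cell l').
  rewrite product_measure1E//; last exact: measurable_cell.
  rewrite IHn => [|i]; last by rewrite mxE.
  rewrite [X in (X * _)%E]lebesgue_measure_itv/= lte_fin; case: ltP => [_|l00].
    rewrite sube0 -EFinM big_ord_recl; congr (_ * _)%:E.
    by apply: eq_bigr => i _; rewrite mxE.
  by rewrite mul0e big_ord_recl (_ : l ord0 0 = 0) ?mul0r//;
    apply/eqP; rewrite eq_le l00 l0.
apply/seteqP; split => [[x y] /= xy|[x y] /= [x0 y0] i].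
  split; first by have := xy ord0; rewrite mxE unlift_none.
  by move=> i; have := xy (lift ord0 i); rewrite !mxE liftK.
by case: (unliftP ord0 i) => [j|] ->; rewrite mxE ?unlift_none//= liftK/=;
  have := y0 j; rewrite mxE.
Qed.

Section periodic_sobolev.
Context {R : realType} {d : nat} (ell : 'cV[R]_d).
Local Notation Rd := 'cV[R]_d.

Definition canon (i : 'I_d) : Rd := delta_mx i 0.

Definition dot (u v : Rd) : R := \sum_i u i 0 * v i 0.

(* Lebesgue measure on Y; functions on Y are functions on R^d whose values
   outside Y are irrelevant. *)
Definition lebY : {measure set Rd -> \bar R} :=
  mrestr (leb d) (measurable_cell ell).

Definition volY : R := fine (leb d (cell ell)).

Definition L2 (v : Rd -> R) : Prop := v \in Lfun lebY 2%:E.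

Definition L2v (V : Rd -> Rd) : Prop := forall i, L2 (fun y => V y i 0).

Definition ip (u v : Rd -> R) : R := \int[lebY]_y (u y * v y).

Definition ipv (U V : Rd -> Rd) : R := \int[lebY]_y dot (U y) (V y).

Definition mean (v : Rd -> R) : R := volY^-1 * \int[lebY]_y v y.

(* [partials [:: i1; ...; ik] f] is d/dy_i1 ... d/dy_ik f. *)
Definition partials (s : seq 'I_d) (f : Rd -> R) : Rd -> R :=
  foldr (fun i g => 'D_(canon i) g) f s.

Definition smooth (f : Rd -> R) : Prop := forall s,
  continuous (partials s f) /\
  (forall i y, derivable (partials s f) y (canon i)).

Definition test_function (f : Rd -> R) : Prop :=
  [/\ smooth f, compact (closure [set y | f y != 0])
    & closure [set y | f y != 0] `<=` cell ell].

Definition is_weak_grad (v : Rd -> R) (G : Rd -> Rd) : Prop :=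
  forall i f, test_function f ->
    ip v ('D_(canon i) f) = - ip (fun y => G y i 0) f.

Definition H1 (v : Rd -> R) : Prop :=
  L2 v /\ exists2 G, L2v G & is_weak_grad v G.

(* The weak gradient in L^2(Y)^d, chosen among its a.e.-equal representatives
   (meaningful for v in H^1(Y) only). *)
Definition grad (v : Rd -> R) : Rd -> Rd :=
  xget (fun=> 0) [set G | L2v G /\ is_weak_grad v G].

Definition H1norm (v : Rd -> R) : R :=
  Num.sqrt (ip v v + ipv (grad v) (grad v)).

Definition periodic (f : Rd -> R) : Prop :=
  forall i y, f (y + ell i 0 *: canon i) = f y.

Definition H1per (v : Rd -> R) : Prop :=
  H1 v /\ forall e : R, 0 < e ->
    exists f, [/\ smooth f, periodic f & H1norm (fun y => v y - f y) < e].

Definition Wper (v : Rd -> R) : Prop := H1per v /\ mean v = 0.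

End periodic_sobolev.

Section tensors.
Context {R : realType} {d : nat}.

(* A tensor of order n is given by its components, indexed by sequences of
   length n; values at sequences of any other length are irrelevant. *)
Definition tensor : Type := seq 'I_d -> R.

Definition Sym n (q : tensor) (s : n.-tuple 'I_d) : R :=
  n`!%:R^-1 * \sum_(sg : 'S_n) q [tuple tnth s (sg i) | i < n].

Definition eqS n (p q : tensor) : Prop :=
  forall s : n.-tuple 'I_d, Sym p s = Sym q s.

(* [otimes m p q] is the tensor product of p, of order m, with q. *)
Definition otimes m (p q : tensor) : tensor :=
  fun s => p (take m s) * q (drop m s).

End tensors.
Arguments tensor : clear implicits.

Section correctors.
Context {R : realType} {d : nat} (ell : 'cV[R]_d) (a : 'cV[R]_d -> 'M[R]_d).
Local Notation Rd := 'cV[R]_d.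
Local Notation grad := (grad ell).
Local Notation ip := (ip ell).
Local Notation ipv := (ipv ell).
Local Notation mean := (mean ell).

Definition admissible_tensor (lambda Lambda : R) : Prop :=
  (forall i j, measurable_fun [set: Rd] (fun y => a y i j : measurableTypeR R))
  /\ {ae leb d, forall y, [/\ (a y)^T = a y,
       forall i, a (y + ell i 0 *: canon i) = a y
     & forall xi : Rd,
         lambda * dot xi xi <= dot (a y *m xi) xi <= Lambda * dot xi xi]}.

(* [chi k [:: i1; ...; ik]] is the component (i1, ..., ik) of the k-th
   corrector. *)
Variable chi : nat -> seq 'I_d -> Rd -> R.

Definition gten m : tensor R d := fun s =>
  if s is i1 :: i2 :: s' then
    (volY ell)^-1 *
    ipv (fun y => a y *m (grad (chi m.+1 (i2 :: s')) y
                          + chi m s' y *: canon i2))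
        (fun=> canon i1)
  else 0.

Definition pten m : tensor R d := if odd m then fun=> 0 else gten m.

Definition corrector_rhs k (w : Rd -> R) : tensor R d := fun s =>
  if s is i1 :: i2 :: s' then
    - ipv (fun y => chi k (i2 :: s') y *: (a y *m canon i1)) (grad w)
    + ipv (fun y => a y *m (grad (chi k (i2 :: s')) y
                            + chi k.-1 s' y *: canon i2))
          (fun y => w y *: canon i1)
    - \sum_(0 <= j < k)
        ip (fun y => otimes (k.-1 - j).+2 (pten (k.-1 - j)) (chi j ^~ y) s) w
  else 0.

Definition correctors : Prop :=
  [/\ chi 0 [::] = (fun=> 1),
      forall i, Wper ell (chi 1 [:: i]) /\
        forall w, Wper ell w ->
          ipv (fun y => a y *m grad (chi 1 [:: i]) y) (grad w)
          = - ipv (fun y => a y *m canon i) (grad w)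
    & forall k, (1 <= k)%N -> forall s : k.+1.-tuple 'I_d,
        [/\ Wper ell (chi k.+1 s),
            forall sg : 'S_k.+1,
              chi k.+1 [tuple tnth s (sg i) | i < k.+1] = chi k.+1 s
                %[ae lebY ell]
          & forall w, H1per ell w ->
              ipv (fun y => a y *m grad (chi k.+1 s) y) (grad w)
              = Sym (corrector_rhs k w) s]].

Definition kten r : tensor R d := fun s =>
  - mean (fun y => dot (a y *m grad (chi r.+1 (take r.+1 s)) y)
                       (grad (chi r.+1 (drop r.+1 s)) y))
  + (if s is i1 :: i2 :: s' then
       mean (fun y => dot (chi r (take r s') y *: (a y *m canon i2))
                          (chi r (drop r s') y *: canon i1))
     else 0).

Definition gchichi m p q : tensor R d := fun s =>
  mean (fun y =>
    otimes m.+2 (gten m) (otimes p (chi p ^~ y) (chi q ^~ y)) s).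

Definition hten_odd r : tensor R d := fun s =>
  \sum_(1 <= j < (uphalf r).+1) \sum_(1 <= l < (uphalf r).+1)
    gchichi (2 * (r + 1 - j - l)) (2 * j - 1) (2 * l - 1) s.

Definition hten_even r : tensor R d := fun s =>
  \sum_(1 <= j < r./2.+1) \sum_(1 <= l < r./2.+1)
    gchichi (2 * (r - j - l)) (2 * j) (2 * l) s.

Definition hten r : tensor R d := fun s => hten_odd r s - hten_even r s.

End correctors.

(* Main.v *)
Require Import Defs.
From HB Require Import structures.
From mathcomp Require Import all_boot all_order all_algebra all_fingroup.
From mathcomp Require Import all_classical all_reals all_analysis.
From mathcomp Require Import measurable_realfun zify ring lra.

(** Write G(n,j), V(k,j), W(k,j) for the symmetrized means of
    a grad chi^n . grad chi^j,   chi^k a e . grad chi^j,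
    chi^k a e . e chi^j,
    and T(i,j) for that of p (x) chi^i (x) chi^j, where p is the tensor g of
    order completing the total order to 2r+2.  Symmetrizing over all 2r+2
    indices absorbs the partial symmetrizations in the corrector problems and
    all reorderings of the indices, so these are plain real numbers.  G is
    symmetric in its two arguments because a is, W and T because products of
    functions commute.

    Testing the problem for chi^(k+1) with chi^j, where k, j >= 1 and
    k + 1 + j = 2r + 2, gives
      G(k+1,j) + V(k,j) - V(j,k) - W(k-1,j) + sum_(i < k) T(i,j) = 0.
    Testing the problem for chi^(j+1) with chi^k exchanges k and j, so V cancels
    in the sum of the two identities.  With
      K_m = G(m,2r+2-m) - W(m-1,2r+1-m)
    what is left is
      K_m + K_(m+1) = - sum of terms T       for 1 <= m <= r,
    a recurrence with alternating signs.  It starts at g^(2r) = - K_1, which is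
    the definition of g^(2r) combined with the problem of chi^1 tested with
    chi^(2r+1), and it ends at - K_(r+1), which is k^r.  This is
    [corrector_recurrence].

    The terms T collected on the way involve pairs (i,j) outside the square
    [1,r] x [1,r], where h^r lives.  Since p vanishes in odd order, T(i,j) = 0
    unless i and j have the same parity, and T(0,j) = 0 because chi^j has mean
    zero; the terms outside the square then cancel in pairs
    ([fold_double_sum]), and inside it the sign is + for odd indices and
    - for even ones ([sum_same_parity]).

    The analysis is confined to integrability and symmetry of the energy
    pairing: a is symmetric and essentially bounded, so products of L^2 fields
    against a are integrable.  The corrector problems enter through their weak
    form, tested with correctors of positive order. *)

Set Implicit Arguments.
Unset Strict Implicit.
Unset Printing Implicit Defensive.

Import Order.TTheory GRing.Theory Num.Theory.
Import numFieldNormedType.Exports.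

Local Open Scope classical_set_scope.
Local Open Scope ring_scope.

(** * The recurrence between corrector energies *)

Lemma alternating_telescope (R : comPzRingType) (K : nat -> R) r :
  K 1%N = (-1) ^+ r * K r.+1 +
          \sum_(1 <= m < r.+1) (-1) ^+ m.+1 * (K m + K m.+1).
Proof.
elim: r => [|r IHr]; first by rewrite big_geq// addr0 mul1r.
by rewrite big_nat_recr//= {1}IHr !exprS; ring.
Qed.

(** The range of the left-hand side leaves the square [1,r] x [1,r] in two
    triangles: i < m paired with the second index 2r+1-m, and, after exchanging
    the arguments of T and putting i = 2r+1-l, the pairs (m,l) with m < l
    and second index 2r+1-l.  These are the same terms
    T(i,2r+1-m) with i < m, once with sign (-1)^(m+1) and once with
    (-1)^(i+1).  When T(i,2r+1-m) is nonzero, i and m have opposite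
    parities, so the two triangles cancel. *)
Lemma fold_double_sum (R : comPzRingType) (r : nat) (T : nat -> nat -> R)
    (T_sym : forall i j, (i + j <= 2 * r)%N -> T i j = T j i)
    (T_odd : forall i j, odd (i + j) -> T i j = 0)
    (T_0 : forall j, (0 < j <= 2 * r)%N -> T 0%N j = 0) :
  \sum_(1 <= m < r.+1) (-1) ^+ m.+1 *
    (\sum_(0 <= i < m) T i ((2 * r).+1 - m)%N +
     \sum_(0 <= i < (2 * r).+1 - m) T i m) =
  \sum_(1 <= m < r.+1) \sum_(1 <= l < r.+1) (-1) ^+ m.+1 * T m l.
Proof.
have lower m : (1 <= m < r.+1)%N ->
    \sum_(0 <= i < m) T i ((2 * r).+1 - m)%N =
    \sum_(1 <= i < r.+1 | (i < m)%N) T i ((2 * r).+1 - m)%N.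
  move=> mr; rewrite big_ltn ?T_0 ?add0r; [|lia..].
  rewrite [RHS](@big_cat_nat _ _ _ m)/=; [|lia..].
  rewrite [X in _ = _ + X]big_nat_cond [X in _ = _ + X]big_pred0 ?addr0.
    by rewrite [LHS]big_nat_cond [RHS]big_nat_cond; apply: eq_bigl => i; lia.
  by move=> i; lia.
have upper m : (1 <= m < r.+1)%N ->
    \sum_(0 <= i < (2 * r).+1 - m) T i m =
    \sum_(1 <= l < r.+1) T m l +
    \sum_(1 <= l < r.+1 | (m < l)%N) T m ((2 * r).+1 - l)%N.
  move=> mr; rewrite big_ltn ?T_0 ?add0r; [|lia..].
  rewrite (@big_cat_nat _ _ _ r.+1)/=; [|lia..]; congr (_ + _).
    by apply: eq_big_nat => i ir; rewrite T_sym//; lia.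
  rewrite [RHS](@big_cat_nat _ _ _ m.+1)/=; [|lia..].
  rewrite [X in _ = X + _]big_nat_cond [X in _ = X + _]big_pred0 ?add0r; last first.
    by move=> i; lia.
  rewrite big_nat_rev/=.
  have {1}-> : (r.+1 = m.+1 + (r - m))%N by lia.
  rewrite big_addn (_ : ((2 * r).+1 - m - (r - m) = r.+1)%N); last by lia.
  rewrite big_nat [RHS]big_nat_cond; apply: eq_big => [l|l lr]; first by lia.
  by rewrite T_sym; [congr T; lia|lia].
transitivity (\sum_(1 <= m < r.+1) \sum_(1 <= l < r.+1) (-1) ^+ m.+1 * T m l +
  (\sum_(1 <= m < r.+1) \sum_(1 <= i < r.+1 | (i < m)%N)
      (-1) ^+ m.+1 * T i ((2 * r).+1 - m)%N +
   \sum_(1 <= m < r.+1) \sum_(1 <= l < r.+1 | (m < l)%N)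
      (-1) ^+ m.+1 * T m ((2 * r).+1 - l)%N)).
  rewrite -!big_split/=; apply: eq_big_nat => m mr.
  by rewrite lower// upper// -!big_distrr/=; ring.
rewrite [X in _ + X](_ : _ = 0) ?addr0//.
rewrite (exchange_big_dep_nat predT)//= -big_split/=.
rewrite big_nat big1// => i ir.
rewrite -big_split/= big1_seq// => m; rewrite mem_index_iota => /andP[im mr].
have [e|o] := boolP (odd (i + m)).
  have -> : (-1) ^+ m.+1 = - (-1) ^+ i.+1 :> R.
    rewrite -[LHS]signr_odd -[X in _ = - X]signr_odd (_ : odd m.+1 = ~~ odd i.+1).
      by case: (odd i.+1); rewrite ?expr0 ?expr1 ?opprK.
    by lia.
  by rewrite mulNr addNr.
by rewrite T_odd ?mulr0 ?addr0//; lia.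
Qed.

Lemma sum_odd_even (V : nmodType) (F : nat -> V) r :
  \sum_(1 <= m < r.+1) F m =
  \sum_(1 <= j < (uphalf r).+1) F (2 * j - 1)%N +
  \sum_(1 <= j < r./2.+1) F (2 * j)%N.
Proof.
elim: r => [|r IHr]; first by rewrite !big_geq// addr0.
rewrite big_nat_recr// IHr; case: (boolP (odd r)) => ro.
  have -> : uphalf r.+1 = uphalf r by lia.
  have -> : r.+1./2 = r./2.+1 by lia.
  rewrite [X in _ = _ + X]big_nat_recr//= -addrA; congr (_ + (_ + F _)).
  by lia.
have -> : uphalf r.+1 = (uphalf r).+1 by lia.
have -> : r.+1./2 = r./2 by lia.
rewrite [X in _ = X + _]big_nat_recr//= addrAC; congr (_ + F _ + _).
by lia.
Qed.

Lemma sum_same_parity (R : comPzRingType) (r : nat) (T : nat -> nat -> R)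
    (T_odd : forall i j, odd (i + j) -> T i j = 0) :
  \sum_(1 <= m < r.+1) \sum_(1 <= l < r.+1) (-1) ^+ m.+1 * T m l =
  \sum_(1 <= j < (uphalf r).+1) \sum_(1 <= l < (uphalf r).+1)
     T (2 * j - 1)%N (2 * l - 1)%N -
  \sum_(1 <= j < r./2.+1) \sum_(1 <= l < r./2.+1) T (2 * j)%N (2 * l)%N.
Proof.
rewrite sum_odd_even -sumrN; congr (_ + _); apply: eq_big_nat => j j1.
  rewrite sum_odd_even [X in _ + X]big_nat [X in _ + X]big1 ?addr0; last first.
    by move=> l l1; rewrite T_odd ?mulr0//; lia.
  by apply: eq_big_nat => l l1; rewrite -signr_odd (_ : odd _ = false) ?mul1r//; lia.
rewrite sum_odd_even big_nat big1 ?add0r; last first.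
  by move=> l l1; rewrite T_odd ?mulr0//; lia.
rewrite -sumrN; apply: eq_big_nat => l l1.
by rewrite -signr_odd (_ : odd _ = true) ?mulN1r//; lia.
Qed.

(** [E] is the problem of the corrector of order k+1 tested with the one of
    order j, and [E1] the problem of the first corrector; A, B, C stand for the
    pairings gradient-gradient, vector-gradient and vector-vector.  B is the
    only one that is not symmetric, and adding [E] for (k,j) and for (j,k)
    eliminates it. *)
Lemma corrector_recurrence (R : comPzRingType) (r : nat)
    (A B C T : nat -> nat -> R)
    (A_sym : forall n j, (0 < n)%N -> (0 < j)%N -> (n + j = 2 * r + 2)%N ->
       A n j = A j n)
    (C_sym : forall n j, (n + j = 2 * r)%N -> C n j = C j n)
    (T_sym : forall i j, (i + j <= 2 * r)%N -> T i j = T j i)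
    (T_odd : forall i j, odd (i + j) -> T i j = 0)
    (T_0 : forall j, (0 < j <= 2 * r)%N -> T 0%N j = 0)
    (E1 : A 1%N (2 * r).+1 + B 0%N (2 * r).+1 = 0)
    (E : forall k j, (0 < k)%N -> (0 < j)%N -> (k + j = (2 * r).+1)%N ->
       A k.+1 j + B k j - B j k - C k.-1 j + \sum_(0 <= i < k) T i j = 0) :
  B 0%N (2 * r).+1 + C (2 * r)%N 0%N =
  (-1) ^+ r * (- A r.+1 r.+1 + C r r) +
  (\sum_(1 <= j < (uphalf r).+1) \sum_(1 <= l < (uphalf r).+1)
     T (2 * j - 1)%N (2 * l - 1)%N -
   \sum_(1 <= j < r./2.+1) \sum_(1 <= l < r./2.+1) T (2 * j)%N (2 * l)%N).
Proof.
rewrite -sum_same_parity// -fold_double_sum//.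
pose K m := A m (2 * r + 2 - m)%N - C m.-1 ((2 * r).+1 - m)%N.
have K_step m : (1 <= m < r.+1)%N -> K m + K m.+1 =
    - (\sum_(0 <= i < m) T i ((2 * r).+1 - m)%N +
       \sum_(0 <= i < (2 * r).+1 - m) T i m).
  move=> mr; set n := ((2 * r).+1 - m)%N.
  have Em := E m n ltac:(lia) ltac:(lia) ltac:(lia).
  have En := E n m ltac:(lia) ltac:(lia) ltac:(lia).
  rewrite /K (_ : (2 * r + 2 - m.+1 = n)%N); last by lia.
  rewrite (_ : (2 * r + 2 - m = n.+1)%N); last by lia.
  rewrite (_ : ((2 * r).+1 - m.+1 = n.-1)%N); last by lia.
  rewrite -/n [A m _]A_sym ?[C m _]C_sym; [|lia..].
  move: Em En; move: (\sum_(0 <= i < m) _) (\sum_(0 <= i < n) _) => P Q Em En.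
  by apply/eqP; rewrite -subr_eq0 opprK -(addr0 0) -{1}Em -En; apply/eqP; ring.
have K1 : B 0%N (2 * r).+1 + C (2 * r)%N 0%N = - K 1%N.
  rewrite /K.
  have [-> ->] : (2 * r + 2 - 1 = (2 * r).+1 /\ (2 * r).+1 - 1 = 2 * r)%N by lia.
  by rewrite C_sym ?addn0// opprB addrC -[B _ _](addKr (A 1%N (2 * r).+1)) E1 addr0.
rewrite K1 (alternating_telescope K r) opprD -mulrN /K.
have [-> ->] : (2 * r + 2 - r.+1 = r.+1 /\ (2 * r).+1 - r.+1 = r)%N by lia.
rewrite opprB [- _ + _]addrC; congr (_ + _); rewrite -sumrN.
by apply: eq_big_nat => m /K_step->; rewrite mulrN opprK.
Qed.

(** * Symmetrization of tensors *)

(* Imported libraries give these two names other meanings. *)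
Local Notation Sym := Defs.Sym.
Local Notation canon := Defs.canon.

Section symmetrization.
Context {R : realType} {d : nat}.
Implicit Types (p q : tensor R d).

Lemma eq_Sym n p q (s : n.-tuple 'I_d) :
  (forall t : n.-tuple 'I_d, p t = q t) -> Sym p s = Sym q s.
Proof. by move=> pq; congr (_ * _); apply: eq_bigr => sg _; exact: pq. Qed.

Lemma SymD n p q (s : n.-tuple 'I_d) :
  Sym (fun t => p t + q t) s = Sym p s + Sym q s.
Proof. by rewrite /Sym big_split mulrDr. Qed.

Lemma SymZ n c q (s : n.-tuple 'I_d) :
  Sym (fun t => c * q t) s = c * Sym q s.
Proof. by rewrite /Sym -mulr_sumr mulrCA. Qed.

Lemma SymN n q (s : n.-tuple 'I_d) : Sym (fun t => - q t) s = - Sym q s.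
Proof. by rewrite /Sym sumrN mulrN. Qed.

Lemma Sym_sum n I (r : seq I) (P : pred I) (F : I -> tensor R d)
    (s : n.-tuple 'I_d) :
  Sym (fun t => \sum_(i <- r | P i) F i t) s = \sum_(i <- r | P i) Sym (F i) s.
Proof. by rewrite /Sym exchange_big/= mulr_sumr. Qed.

(** The permutations carrying s to a rearrangement t form a coset of the
    stabilizer of s. *)
Lemma card_rearrangement n (s t : n.-tuple 'I_d) : perm_eq t s ->
  #|[pred sg : 'S_n | [tuple tnth s (sg i) | i < n] == t]| =
  #|[pred sg : 'S_n | [tuple tnth s (sg i) | i < n] == s]|.
Proof.
move=> /tuple_permP[tau /val_inj tE].
rewrite -[RHS](card_imset _ (mulgI tau)); apply: eq_card => sg.
rewrite inE; apply/eqP/imsetP => [stE|[rho + ->]].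
  exists (tau^-1 * sg)%g; last by rewrite mulKVg.
  rewrite inE; apply/eqP/eq_from_tnth => i; rewrite tnth_mktuple permM.
  have := congr1 (fun u => tnth u ((tau^-1)%g i)) stE.
  by rewrite tE !tnth_mktuple permKV.
rewrite inE => /eqP rhoE; apply/eq_from_tnth => i.
rewrite tE !tnth_mktuple permM.
by have := congr1 (fun u => tnth u (tau i)) rhoE; rewrite tnth_mktuple.
Qed.

(** Summing over the distinct rearrangements of the indices, rather than over
    permutations, makes [Sym] insensitive to any bijection of index
    sequences that only reorders them, with no permutation to exhibit. *)
Lemma Sym_rearrangements n q (s : n.-tuple 'I_d) :
  Sym q s = n`!%:R^-1 *
    #|[pred sg : 'S_n | [tuple tnth s (sg i) | i < n] == s]|%:R *
    \sum_(t : n.-tuple 'I_d | perm_eq t s) q t.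
Proof.
rewrite /Sym -mulrA; congr (_ * _).
rewrite (partition_big (fun sg : 'S_n => [tuple tnth s (sg i) | i < n])
  (fun t : n.-tuple 'I_d => perm_eq t s))/=; last first.
  by move=> sg _; apply/tuple_permP; exists sg.
rewrite mulr_sumr; apply: eq_bigr => t ts.
rewrite -(card_rearrangement ts) -sum1_card natr_sum mulr_suml.
by apply: eq_big => [sg|sg /eqP <-]; rewrite ?inE ?mul1r.
Qed.

Lemma Sym_slots n p q (s : n.-tuple 'I_d)
    (phi : n.-tuple 'I_d -> n.-tuple 'I_d) :
  injective phi -> (forall t : n.-tuple 'I_d, perm_eq (phi t) t) ->
  (forall t : n.-tuple 'I_d, p t = q (phi t)) -> Sym p s = Sym q s.
Proof.
move=> phi_inj phi_perm pq; rewrite !Sym_rearrangements; congr (_ * _).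
rewrite [RHS](reindex_inj phi_inj); apply: eq_big => [t|t _]; last exact: pq.
by rewrite (permPl (phi_perm t)).
Qed.

Definition block_swap h n (t : seq 'I_d) : seq 'I_d :=
  take h t ++ rot n (drop h t).

Lemma perm_block_swap h n t : perm_eq (block_swap h n t) t.
Proof. by rewrite -[X in perm_eq _ X](cat_take_drop h) perm_cat2l perm_rot. Qed.

Lemma block_swap_inj h n : injective (block_swap h n).
Proof.
move=> t u tu; have sz : size t = size u.
  by rewrite -(perm_size (perm_block_swap h n t)) tu (perm_size (perm_block_swap _ _ _)).
move/eqP: tu; rewrite eqseq_cat ?size_take ?sz// => /andP[/eqP t1 /eqP/rot_inj t2].
by rewrite -(cat_take_drop h t) t1 t2 cat_take_drop.
Qed.

Lemma Sym_slots_seq n p q (s : n.-tuple 'I_d) (phi : seq 'I_d -> seq 'I_d) :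
  injective phi -> (forall t, perm_eq (phi t) t) ->
  (forall t : n.-tuple 'I_d, p t = q (phi t)) -> Sym p s = Sym q s.
Proof.
move=> phi_inj phi_perm pq.
have sz (t : n.-tuple 'I_d) : size (phi t) == n.
  by rewrite (perm_size (phi_perm t)) size_tuple.
apply: (@Sym_slots _ _ _ _ (fun t => Tuple (sz t))) => //= t u [].
by move=> /phi_inj/val_inj.
Qed.

Lemma Sym_block_swap h m j N p q (s : N.-tuple 'I_d) : (h + (m + j) = N)%N ->
  (forall u v w, size u = h -> size v = m -> size w = j ->
     p (u ++ v ++ w) = q (u ++ w ++ v)) ->
  Sym p s = Sym q s.
Proof.
move=> Nhmj pq; apply: (@Sym_slots_seq _ _ _ _ (block_swap h m)) => [||t].
- exact: block_swap_inj.
- exact: perm_block_swap.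
rewrite /block_swap /rot -[in LHS](cat_take_drop h t).
rewrite -[X in p (_ ++ X)](cat_take_drop m) pq//.
- by rewrite size_takel// size_tuple -Nhmj leq_addr.
- by rewrite size_takel// size_drop size_tuple -Nhmj addKn leq_addr.
- by rewrite !size_drop size_tuple -Nhmj !addKn.
Qed.

(** Each permutation of the first m slots is a reordering of all slots, hence
    leaves the full symmetrization unchanged; a partial symmetrization is an
    average of these. *)
Lemma Sym_Sym m j N p q (s : N.-tuple 'I_d) : (m + j = N)%N ->
  (forall (u : m.-tuple 'I_d) (v : seq 'I_d), size v = j ->
     p (u ++ v) = Sym (fun u' => q (u' ++ v)) u) ->
  Sym p s = Sym q s.
Proof.
move=> mjN; case: _ / mjN s => s pq.
pose phi (pi : 'S_m) (t : (m + j).-tuple 'I_d) : (m + j).-tuple 'I_d :=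
  [tuple of [tuple tnth t (lshift j (pi i)) | i < m] ++
            [tuple tnth t (rshift m i) | i < j]].
have phiE pi t (k : 'I_(m + j)) : tnth (phi pi t) k =
    match fintype.split k with inl i => tnth t (lshift j (pi i))
                     | inr i => tnth t (rshift m i) end.
  rewrite -[in LHS](splitK k) /unsplit; case: (fintype.split k) => i.
    by rewrite tnth_lshift tnth_mktuple.
  by rewrite tnth_rshift tnth_mktuple.
have phi_inj pi : injective (phi pi).
  move=> t u tu; apply: eq_from_tnth => k; rewrite -(splitK k) /unsplit.
  case: (fintype.split k) => i.
    have := congr1 (fun v => tnth v (lshift j ((pi^-1)%g i))) tu.
    by rewrite !phiE -[lshift _ _]/(unsplit (inl _)) unsplitK permKV.
  have := congr1 (fun v => tnth v (rshift m i)) tu.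
  by rewrite !phiE -[rshift _ _]/(unsplit (inr _)) unsplitK.
have id_split (t : (m + j).-tuple 'I_d) :
    tval t = [tuple tnth t (lshift j i) | i < m] ++
             [tuple tnth t (rshift m i) | i < j].
  apply: (congr1 val (x := t) (y := [tuple of _ ++ _])).
  apply: eq_from_tnth => k; rewrite -(splitK k) /unsplit.
  by case: (fintype.split k) => i; rewrite ?tnth_lshift ?tnth_rshift tnth_mktuple.
have phi_perm pi t : perm_eq (phi pi t) t.
  rewrite [X in perm_eq _ X]id_split /= perm_cat2r.
  apply/(tuple_permP (t := [tuple tnth t (lshift j i) | i < m])).
  exists pi; apply: (congr1 (@tval m _)
    (x := [tuple tnth t (lshift j (pi i)) | i < m])).
  by apply: eq_from_tnth => i; rewrite !tnth_mktuple.
(* A tensor is defined on sequences of every length, hence the [insub]; on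
   the relevant length the default 0 is not reached. *)
transitivity (Sym (fun t => m`!%:R^-1 * \sum_(pi : 'S_m)
    (if insub t is Some t' then q (phi pi t') else 0)) s).
  apply: eq_Sym => t; rewrite [in LHS]id_split pq ?size_tuple//.
  congr (_ * _); apply: eq_bigr => pi _; rewrite valK /=; congr (q (_ ++ _)).
  by apply: eq_map => i; rewrite tnth_mktuple.
rewrite SymZ Sym_sum (eq_bigr (fun=> Sym q s)) => [|pi _]; last first.
  apply: (@Sym_slots _ _ _ _ (phi pi)) => // t.
  by rewrite valK.
by rewrite sumr_const card_Sn -(mulr_natl (Sym q s)) mulrA mulVf ?mul1r//.
Qed.

End symmetrization.

(** * The energy pairing *)

Section dot_theory.
Context {R : realType} {d : nat}.
Implicit Types (u v w : 'cV[R]_d) (M : 'M[R]_d).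

Lemma dotDl u v w : dot (u + v) w = dot u w + dot v w.
Proof.
by rewrite /dot -big_split; apply: eq_bigr => i _; rewrite mxE mulrDl.
Qed.

Lemma dotZl c u v : dot (c *: u) v = c * dot u v.
Proof.
by rewrite /dot mulr_sumr; apply: eq_bigr => i _; rewrite mxE mulrA.
Qed.

Lemma dotZr c u v : dot u (c *: v) = c * dot u v.
Proof.
by rewrite /dot mulr_sumr; apply: eq_bigr => i _; rewrite mxE mulrCA.
Qed.

Lemma dot_mulmx_sym M u v : M^T = M -> dot (M *m u) v = dot (M *m v) u.
Proof.
have dotE x y : dot (M *m x) y = \sum_i \sum_j M i j * x j 0 * y i 0.
  by apply: eq_bigr => i _; rewrite mxE mulr_suml.
move=> MT; rewrite !dotE exchange_big; apply: eq_bigr => i _; apply: eq_bigr => j _.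
by rewrite -{1}MT mxE mulrAC.
Qed.

Lemma dot_mulmx_canon M i j : dot (M *m canon j) (canon i) = M i j :> R.
Proof.
rewrite /dot (bigD1 i)//= big1 => [|k ki]; last first.
  by rewrite [canon i k 0]mxE (negbTE ki) mulr0.
by rewrite addr0 [canon i i 0]mxE !eqxx mulr1 -colE mxE.
Qed.

(** Polarization: 2 M_ij is the value of the quadratic form at e_i + e_j minus
    its values at e_i and e_j. *)
Lemma sym_elliptic_entry_le M Lambda : M^T = M ->
  (forall xi, 0 <= dot (M *m xi) xi <= Lambda * dot xi xi) ->
  forall i j, `|M i j| <= 2 * Lambda.
Proof.
move=> MT ell i j.
have dcc (k l : 'I_d) : dot (canon k) (canon l) = (k == l)%:R :> R.
  by have := dot_mulmx_canon 1%:M l k; rewrite mul1mx mxE eq_sym.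
have diag k : 0 <= M k k <= Lambda.
  by have := ell (canon k); rewrite dot_mulmx_canon dcc eqxx mulr1.
have dotC u v : dot u v = dot v u by apply: eq_bigr => k _; rewrite mulrC.
have := ell (canon i + canon j).
rewrite mulmxDr !dotDl ![dot _ (_ + _)]dotC !dotDl ![dot _ (_ *m _)]dotC.
rewrite !dot_mulmx_canon !dcc !eqxx (eq_sym j i).
have -> : M j i = M i j by rewrite -{1}MT mxE.
move: (diag i) (diag j); rewrite ler_norml; case: (i == j) => /=; lra.
Qed.

End dot_theory.

Section energy.
Context {R : realType} {d : nat} (ell : 'cV[R]_d) (a : 'cV[R]_d -> 'M[R]_d).
Context (lambda Lambda : R).
Hypothesis lambda_ge0 : 0 <= lambda.
Hypothesis ha : admissible_tensor ell a lambda Lambda.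
Local Notation Rd := 'cV[R]_d.
Local Notation mu := (lebY ell).

Lemma lebY_ae (P : Rd -> Prop) :
  {ae leb d, forall y, P y} -> {ae mu, forall y, P y}.
Proof.
move=> [N [mN N0 PN]]; exists N; split => //.
apply/eqP; rewrite -measure_le0 -N0 /lebY /mrestr.
by apply: le_measure; rewrite ?inE//; exact: measurableI (measurable_cell ell).
Qed.

Lemma tensor_ae_bounded :
  {ae mu, forall y, (a y)^T = a y /\ forall i j, `|a y i j| <= 2 * Lambda}.
Proof.
apply: lebY_ae; case: ha => _; apply: filterS => y [aT _ aell]; split=> //.
apply: sym_elliptic_entry_le => // xi; case/andP: (aell xi) => l1 ->.
rewrite andbT (le_trans _ l1)// mulr_ge0// sumr_ge0// => i _.
by rewrite -expr2 sqr_ge0.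
Qed.

Lemma L2_measurable v : L2 ell v -> measurable_fun setT v.
Proof. by rewrite /L2 inE => /andP[]; rewrite inE. Qed.

Lemma L2_integrableM u v : L2 ell u -> L2 ell v ->
  mu.-integrable setT (EFin \o (fun y => u y * v y)).
Proof. by move=> u2 v2; apply/Lfun1_integrable; exact: Lfun2_mul_Lfun1. Qed.

Lemma measurable_energy U V : L2v ell U -> L2v ell V ->
  measurable_fun setT (fun y => dot (a y *m U y) (V y)).
Proof.
move=> U2 V2; rewrite /dot; apply: measurable_sum => i.
apply: measurable_funM; last exact: L2_measurable.
under eq_fun do rewrite mxE; apply: measurable_sum => j.
by case: ha => ma _; apply: measurable_funM; [exact: ma|exact: L2_measurable].
Qed.

(** The integrand is dominated, almost everywhere, by the sum g of the products
    |U_j V_i| of L^2 functions, weighted by the bound on the entries of a. *)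
Lemma integrable_energy U V : L2v ell U -> L2v ell V ->
  mu.-integrable setT (EFin \o (fun y => dot (a y *m U y) (V y))).
Proof.
move=> U2 V2; have mUV := measurable_energy U2 V2.
pose g y := \sum_i \sum_j 2 * Lambda * `|U y j 0 * V y i 0|.
have ig : mu.-integrable setT (EFin \o g).
  rewrite (_ : EFin \o g = (fun y => \sum_i \sum_j
      (2 * Lambda * `|U y j 0 * V y i 0|)%:E)%E); last first.
    by apply/funext => y; rewrite /= /g -sumEFin; apply: eq_bigr => i _; rewrite -sumEFin.
  apply: integrable_sum => // i _; apply: integrable_sum => // j _.
  have := integrableZl measurableT (2 * Lambda)
    (integrable_norm (L2_integrableM (U2 j) (V2 i))).
  by [].
have /integrableP[mg goo] := ig.
apply/integrableP; split; first exact/measurable_EFinP.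
apply: le_lt_trans goo; apply: ae_ge0_le_integral => //.
- by apply: measurableT_comp => //; exact/measurable_EFinP.
- by apply: measurableT_comp.
apply: filterS tensor_ae_bounded => y [_ aL] _ /=.
rewrite lee_fin [X in _ <= X]ger0_norm; last first.
  rewrite sumr_ge0// => i _; rewrite sumr_ge0// => j _.
  by rewrite mulr_ge0// (le_trans _ (aL i j)).
rewrite (le_trans (ler_norm_sum _ _ _))//; apply: ler_sum => i _.
rewrite mxE mulr_suml (le_trans (ler_norm_sum _ _ _))//; apply: ler_sum => j _.
by rewrite -mulrA normrM ler_wpM2r.
Qed.

Lemma ipv_sym U V : L2v ell U -> L2v ell V ->
  ipv ell (fun y => a y *m U y) V = ipv ell (fun y => a y *m V y) U.
Proof.
move=> U2 V2; congr fine; apply: ae_eq_integral => //.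
- by apply/measurable_EFinP; exact: measurable_energy.
- by apply/measurable_EFinP; exact: measurable_energy.
by apply: filterS tensor_ae_bounded => y [aT _] _; rewrite dot_mulmx_sym.
Qed.

Lemma ipvDl U W V : L2v ell U -> L2v ell W -> L2v ell V ->
  ipv ell (fun y => a y *m (U y + W y)) V =
  ipv ell (fun y => a y *m U y) V + ipv ell (fun y => a y *m W y) V.
Proof.
move=> U2 W2 V2; rewrite -RintegralD//; [|exact: integrable_energy..].
by apply: eq_Rintegral => y _; rewrite mulmxDr dotDl.
Qed.

Lemma L2v_scale v (i : 'I_d) : L2 ell v -> L2v ell (fun y => v y *: canon i).
Proof.
move=> v2 j; rewrite /L2 (_ : (fun _ => _) = (j == i)%:R \o* v).
  by apply: Lfun_scale => //; rewrite ler1n.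
by apply/funext => y; rewrite !mxE eqxx andbT.
Qed.

(** The cell has finite measure. *)
Lemma L2_cst (ell_gt0 : forall i, 0 < ell i 0) c : L2 ell (fun=> c).
Proof.
rewrite /L2 inE; apply/andP; split; rewrite inE//=.
rewrite /finite_norm unlock poweR_lty//= integral_cst//= /mrestr setTI.
rewrite leb_cell => [|i]; last exact: ltW.
by rewrite -EFinM ltry.
Qed.

(** The chosen gradient is an L^2 field because some weak gradient in L^2
    exists. *)
Lemma H1_L2v_grad v : H1 ell v -> L2v ell (grad ell v).
Proof.
move=> [_ [G G2 vG]]; rewrite /grad; case: xgetP => [H -> []//|/(_ G)].
by case; split.
Qed.

End energy.

(** * Pairings of correctors *)

Section corrector_pairings.
Context {R : realType} {d : nat} (ell : 'cV[R]_d) (a : 'cV[R]_d -> 'M[R]_d).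
Context (lambda Lambda : R) (chi : nat -> seq 'I_d -> 'cV[R]_d -> R).
Hypothesis ell_gt0 : forall i, 0 < ell i 0.
Hypothesis lambda_ge0 : 0 <= lambda.
Hypothesis ha : admissible_tensor ell a lambda Lambda.
Hypothesis hchi : correctors ell a chi.
Local Notation grad := (grad ell).
Local Notation ip := (ip ell).
Local Notation ipv := (ipv ell).
Local Notation mean := (mean ell).
Local Notation gchichi := (gchichi ell a chi).

(** The pairings G, V, W above, before symmetrization.  The slots of the vectors
    e come first, then those of the first corrector, then those of the
    second. *)
Definition grad_grad n j : tensor R d := fun t =>
  mean (fun y => dot (a y *m grad (chi n (take n t)) y)
                     (grad (chi j (drop n t)) y)).

Definition vec_grad k j : tensor R d := fun t =>
  if t is i :: t' then
    mean (fun y => dot (chi k (take k t') y *: (a y *m canon i))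
                       (grad (chi j (drop k t')) y))
  else 0.

Definition vec_vec k j : tensor R d := fun t =>
  if t is i1 :: i2 :: t' then
    mean (fun y => dot (chi k (take k t') y *: (a y *m canon i2))
                       (chi j (drop k t') y *: canon i1))
  else 0.

Lemma corrector_Wper k s : (0 < k)%N -> size s = k -> Wper ell (chi k s).
Proof.
case: hchi => _ chi1 chiS; case: k => [//|[|k]] _ sz.
  by case: s sz => [//|i []] // _; case: (chi1 i).
have /eqP sz' := sz; by case: (chiS k.+1 erefl (Tuple sz')).
Qed.

Lemma corrector_L2 k s : size s = k -> L2 ell (chi k s).
Proof.
case: k => [|k] sz; last by have [[[]]] := corrector_Wper (ltn0Sn k) sz.
by rewrite (size0nil sz); case: hchi => -> _ _; exact: L2_cst.
Qed.

Lemma corrector_grad_L2 k s : (0 < k)%N -> size s = k ->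
  L2v ell (grad (chi k s)).
Proof. by move=> k0 /(corrector_Wper k0)[[/H1_L2v_grad]]. Qed.

Lemma grad_grad_sym n j N (s : N.-tuple 'I_d) :
  (0 < n)%N -> (0 < j)%N -> (n + j = N)%N ->
  Sym (grad_grad n j) s = Sym (grad_grad j n) s.
Proof.
move=> n0 j0 njN; apply: (@Sym_block_swap _ _ 0 n j) => [|u v w]; first by [].
move=> /size0nil -> sv sw.
rewrite /grad_grad !cat0s (take_size_cat w sv) (drop_size_cat w sv).
rewrite (take_size_cat v sw) (drop_size_cat v sw).
have gv := corrector_grad_L2 n0 sv; have gw := corrector_grad_L2 j0 sw.
exact: congr1 (ipv_sym lambda_ge0 ha gv gw).
Qed.

(** Only the two scalar factors change places; both vectors e keep their
    slots. *)
Lemma vec_vec_sym k j N (s : N.-tuple 'I_d) : (k + j + 2 = N)%N ->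
  Sym (vec_vec k j) s = Sym (vec_vec j k) s.
Proof.
move=> kjN; apply: (@Sym_block_swap _ _ 2 k j) => [|u v w]; first by lia.
case: u => [//|i1 [//|i2 []]]// _ sv sw.
rewrite /vec_vec /= (take_size_cat w sv) (drop_size_cat w sv).
rewrite (take_size_cat v sw) (drop_size_cat v sw).
congr (_ * _); apply: eq_Rintegral => y _.
by rewrite !dotZl !dotZr mulrCA.
Qed.

Lemma gchichi_sym m i j N (s : N.-tuple 'I_d) : (m + 2 + (i + j) = N)%N ->
  Sym (gchichi m i j) s = Sym (gchichi m j i) s.
Proof.
move=> mijN; apply: (@Sym_block_swap _ _ m.+2 i j) => [|u v w su sv sw]; first by lia.
congr (_ * _); apply: eq_Rintegral => y _.
rewrite /otimes !(take_size_cat _ su) !(drop_size_cat _ su).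
rewrite (take_size_cat w sv) (drop_size_cat w sv).
rewrite (take_size_cat v sw) (drop_size_cat v sw).
by congr (_ * _); rewrite mulrC.
Qed.

Lemma gchichi0 m j N (s : N.-tuple 'I_d) : (0 < j)%N -> (m + 2 + j = N)%N ->
  Sym (gchichi m 0 j) s = 0.
Proof.
move=> j0 mjN; rewrite (@eq_Sym _ _ _ _ (fun=> 0)) => [|t].
  by rewrite /Sym big1 ?mulr0.
have sz : size (drop m.+2 t) = j by rewrite size_drop size_tuple; lia.
have [_ mean0] := corrector_Wper j0 sz.
rewrite /Defs.gchichi /otimes take0 drop0.
case: hchi => -> _ _; rewrite /Defs.mean.
under eq_Rintegral do rewrite mul1r.
rewrite RintegralZl//; first by rewrite mulrCA [X in _ * X]mean0 mulr0.
have := L2_integrableM (corrector_L2 sz) (L2_cst ell_gt0 1).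
by under eq_fun do rewrite mulr1.
Qed.

(** Here chi^0 = 1 turns the bare vector e_(i1) into the field
    chi^0 e_(i1) of the pairings. *)
Lemma gten_pairings m (t : (m.+2).-tuple 'I_d) :
  gten ell a chi m t = vec_grad 0 m.+1 t + vec_vec m 0 t.
Proof.
case: t => -[//|i1 [//|i2 t]] /= /eqP[sz].
rewrite take_oversize ?sz// drop_oversize ?sz//.
case: hchi => -> _ _.
have e1 : L2v ell (fun=> canon i1) by move=> k; exact: L2_cst.
have g2 : L2v ell (grad (chi m.+1 (i2 :: t))).
  by apply: corrector_grad_L2 => //=; rewrite sz.
have c2 := L2v_scale i2 (corrector_L2 sz).
rewrite (ipvDl lambda_ge0 ha g2 c2 e1) (ipv_sym lambda_ge0 ha g2 e1) mulrDr.
by congr (_ * _ + _ * _); apply: eq_Rintegral => y _; rewrite ?scale1r// -scalemxAr.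
Qed.

Lemma first_corrector_tested j (t : j.+1.-tuple 'I_d) : (0 < j)%N ->
  grad_grad 1 j t + vec_grad 0 j t = 0.
Proof.
move=> j0; case: t => -[//|i t] /= /eqP[sz].
have Wt := corrector_Wper j0 sz.
rewrite /grad_grad /= take0 drop0; case: hchi => -> chi1 _.
have [_ /(_ _ Wt) chi1E] := chi1 i.
rewrite -mulrDr [X in _ * (X + _)]chi1E addrC.
apply/eqP; rewrite mulf_eq0 subr_eq0; apply/orP; right; apply/eqP.
by apply: eq_Rintegral => y _; rewrite scale1r.
Qed.

(** The i-th term of the zero-order part of the problem of chi^(k+1), tested
    with chi^j: the tensor p is g in even order and 0 in odd order. *)
Definition source k j i : tensor R d :=
  if odd (k.-1 - i) then fun=> 0 else gchichi (k.-1 - i) i j.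

(** By symmetry of a, the term (a grad chi^k, e_(i1) chi^j) is the pairing
    V of chi^j with chi^k, whose slots are ordered with chi^j before
    chi^k: hence the block swap. *)
Lemma corrector_rhs_pairings k j (t : (k.+1 + j).-tuple 'I_d) :
  (0 < k)%N -> (0 < j)%N ->
  (volY ell)^-1 *
    corrector_rhs ell a chi k (chi j (drop k.+1 t)) (take k.+1 t) =
  - vec_grad k j t + vec_grad j k (block_swap 1 k t) + vec_vec k.-1 j t -
  \sum_(0 <= i < k) source k j i t.
Proof.
case: k t => [//|k] t _ j0.
have szt : size t = (k.+2 + j)%N by rewrite size_tuple.
case: t szt => -[//|i1 [//|i2 t]] /= _ [szt].
have szu : size (take k t) = k by rewrite size_takel// szt; lia.
have szv : size (drop k t) = j by rewrite size_drop szt; lia.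
have g2 : L2v ell (grad (chi k.+1 (i2 :: take k t))).
  by apply: corrector_grad_L2 => //=; rewrite szu.
have c2 := L2v_scale i2 (corrector_L2 szu).
have v2 := L2v_scale i1 (corrector_L2 szv).
rewrite (ipvDl lambda_ge0 ha g2 c2 v2) (ipv_sym lambda_ge0 ha g2 v2).
have distr (c x y z w A B C S : R) :
    c * x = A -> c * y = B -> c * z = C -> c * w = S ->
  c * (- x + (y + z) - w) = - A + B + C - S by move=> <- <- <- <-; ring.
have scaleE v i : (fun y => a y *m (v y *: canon i)) =
    (fun y => v y *: (a y *m canon i)).
  by apply/funext => y; rewrite scalemxAr.
rewrite !scaleE; apply: distr; [by []| |by []|].
  rewrite /block_swap /= /rot /=.
  by rewrite (take_size_cat _ szv) (drop_size_cat _ szv).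
rewrite mulr_sumr; apply: eq_big_nat => i /andP[_ ik].
rewrite /source /pten /=; case: ifP => _.
  rewrite (_ : ip _ _ = 0) ?mulr0// /Defs.ip.
  under eq_Rintegral do rewrite /otimes mul0r mul0r.
  by rewrite Rintegral_cst// mul0r.
congr (_ * _); apply: eq_Rintegral => y _.
rewrite /otimes /= -mulrA take_takel ?leq_subr//.
by rewrite take_drop drop_drop subnKC.
Qed.

Lemma kten_pairings r t :
  kten ell a chi r t = - grad_grad r.+1 r.+1 t + vec_vec r r t.
Proof. by []. Qed.

Lemma higher_corrector_tested k j (u : k.+1.-tuple 'I_d) v :
  (0 < k)%N -> (0 < j)%N -> size v = j ->
  grad_grad k.+1 j (u ++ v) =
  Sym (fun u' => (volY ell)^-1 * corrector_rhs ell a chi k (chi j v) u') u.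
Proof.
move=> k0 j0 sv; have [Wv _] := corrector_Wper j0 sv.
case: hchi => _ _ /(_ k k0 u)[_ _ /(_ _ Wv) chiE].
rewrite /grad_grad (take_size_cat _ (size_tuple u)) (drop_size_cat _ (size_tuple u)).
by rewrite SymZ; exact: congr1 chiE.
Qed.

(* Otherwise comparing two pairings unfolds them down to the integrals. *)
Local Opaque grad_grad vec_grad vec_vec Defs.gchichi.

(** The identity that drives the recurrence: the partial symmetrization on the
    right-hand side of the corrector problem disappears in the full one. *)
Lemma corrector_tested k j N (s : N.-tuple 'I_d) :
  (0 < k)%N -> (0 < j)%N -> (k.+1 + j = N)%N ->
  Sym (grad_grad k.+1 j) s + Sym (vec_grad k j) s - Sym (vec_grad j k) s
    - Sym (vec_vec k.-1 j) s + \sum_(0 <= i < k) Sym (source k j i) s = 0.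
Proof.
move=> k0 j0 kjN; case: _ / kjN s => s.
have -> : Sym (grad_grad k.+1 j) s = Sym (fun t => (volY ell)^-1 *
    corrector_rhs ell a chi k (chi j (drop k.+1 t)) (take k.+1 t)) s.
  apply: (@Sym_Sym _ _ k.+1 j) => // u v sv.
  rewrite higher_corrector_tested//; apply: eq_Sym => u'.
  by rewrite (take_size_cat _ (size_tuple u')) (drop_size_cat _ (size_tuple u')).
rewrite (eq_Sym (q := fun t =>
    - vec_grad k j t + vec_grad j k (block_swap 1 k t) + vec_vec k.-1 j t -
    \sum_(0 <= i < k) source k j i t)); last first.
  by move=> t; exact: corrector_rhs_pairings.
have swapE : Sym (fun t => vec_grad j k (block_swap 1 k t)) s =
    Sym (vec_grad j k) s.
  apply: (@Sym_slots_seq _ _ _ _ _ _ (block_swap 1 k)) => //.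
    exact: block_swap_inj.
  exact: perm_block_swap.
have balance (A B C S : tensor R d) (b c : R) : Sym B s = b -> Sym S s = c ->
    Sym (fun t => - A t + B t + C t - S t) s + Sym A s - b - Sym C s + c = 0.
  by move=> <- <-; rewrite !SymD !SymN; ring.
by apply: balance swapE _; exact: Sym_sum.
Qed.

Lemma gten_even_formula r : eqS (2 * r + 2) (gten ell a chi (2 * r))
  (fun s => (-1) ^+ r * kten ell a chi r s + hten ell a chi r s).
Proof.
move=> s.
have -> : Sym (gten ell a chi (2 * r)) s =
    Sym (vec_grad 0 (2 * r).+1) s + Sym (vec_vec (2 * r) 0) s.
  rewrite -SymD; case: _ / (esym (addn2 (2 * r))) s => s.
  by apply: eq_Sym => t; exact: gten_pairings.
(* The tensor in T completes the total order to 2r+2; putting 0 for odd i + j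
   replaces g by p. *)
pose T i j := if odd (i + j) then 0 else Sym (gchichi (2 * r - (i + j)) i j) s.
rewrite (@corrector_recurrence _ _ (fun n j => Sym (grad_grad n j) s)
  (fun k j => Sym (vec_grad k j) s) (fun k j => Sym (vec_vec k j) s) T).
- have split_Sym c (K H G V O E : tensor R d) :
      (forall t, K t = - G t + V t) -> (forall t, H t = O t - E t) ->
      Sym (fun t => c * K t + H t) s =
      c * (- Sym G s + Sym V s) + (Sym O s - Sym E s).
    move=> KE HE; rewrite SymD SymZ -!SymN -!SymD.
    by congr (_ * _ + _); apply: eq_Sym => t; rewrite ?KE ?HE.
  rewrite (split_Sym _ _ _ _ _ _ _ (kten_pairings r) (fun=> erefl)).
  rewrite /hten_odd /hten_even !Sym_sum; congr (_ + _).
  congr (_ - _); apply: eq_big_nat => j jr; rewrite Sym_sum;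
      apply: eq_big_nat => l lr; rewrite /T ifF; try lia.
    have -> // : (2 * r - (2 * j - 1 + (2 * l - 1)) = 2 * (r + 1 - j - l))%N.
    by lia.
  have -> // : (2 * r - (2 * j + 2 * l) = 2 * (r - j - l))%N by lia.
- by move=> n j n0 j0 njr; exact: grad_grad_sym.
- by move=> n j njr; apply: vec_vec_sym; lia.
- by move=> i j ijr; rewrite /T addnC; case: ifP => // _; apply: gchichi_sym; lia.
- by move=> i j; rewrite /T => ->.
- by move=> j jr; rewrite /T; case: ifP => // _; apply: gchichi0; lia.
- rewrite -SymD; have N1 : (2 * r + 2 = (2 * r).+2)%N by lia.
  case: _ / (esym N1) s @T => s.
  rewrite (@eq_Sym _ _ _ _ (fun=> 0)); first by rewrite /Defs.Sym big1 ?mulr0.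
  by move=> t; exact: first_corrector_tested.
(* Since k + j = 2r + 1, the order 2r - (i + j) of T is k - 1 - i. *)
move=> k j k0 j0 kjr; rewrite -[RHS](@corrector_tested k j _ s k0 j0); last by lia.
congr (_ + _); apply: eq_big_nat => i ik.
rewrite /T /source (_ : (2 * r - (i + j) = k.-1 - i)%N); last by lia.
rewrite (_ : odd (i + j) = odd (k.-1 - i)); last by lia.
by case: ifP => // _; rewrite /Defs.Sym big1 ?mulr0.
Qed.

End corrector_pairings.

Theorem theorem3p5 (R : realType) (d : nat) (ell : 'cV[R]_d)
  (a : 'cV[R]_d -> 'M[R]_d) (lambda Lambda : R)
  (chi : nat -> seq 'I_d -> 'cV[R]_d -> R) (alpha : nat)
  (ell_gt0 : forall i, 0 < ell i 0)
  (lambda_gt0 : 0 < lambda) (Lambda_gt0 : 0 < Lambda)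
  (ha : admissible_tensor ell a lambda Lambda)
  (hchi : correctors ell a chi)
  (halpha : (2 <= alpha)%N) :
  forall r : nat, (1 <= r <= alpha./2)%N ->
    eqS (2 * r + 2) (gten ell a chi (2 * r))
        (fun s => (-1) ^+ r * kten ell a chi r s + hten ell a chi r s)
    /\ (r = 1%N ->
        forall s : (2 * r + 2).-tuple 'I_d, hten_even ell a chi r s = 0).
Proof.
move=> r _; split; first exact: gten_even_formula ell_gt0 (ltW lambda_gt0) ha hchi r.
by move=> -> s; rewrite /hten_even big_geq.
Qed.
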